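(* Let $R$ be an associative ring with identity and let $a,b\in R$. If $ab$ is pseudo Drazin invertible, then $ba$ is pseudo Drazin invertible and $(ba)^{pD}=b\big((ab)^{pD}\big)^2a$.
   Context: For $x\in R$, $comm(x)=\{y\in R\mid xy=yx\}$ and $comm^2(x)=\{y\in R\mid yz=zy\text{ for all }z\in comm(x)\}$. $J(R)$ is the Jacobson radical of $R$, and $J^{\#}(R)=\{x\in R\mid x^n\in J(R)\text{ for some positive integer }n\}$. An element $x\in R$ is pseudo Drazin invertible if there is $y\in R$ with $xy^2=y$, $y\in comm^2(x)$ and $x^2y-x\in J^{\#}(R)$. Such a $y$ is unique if it exists; it is called the pseudo Drazin inverse of $x$ and denoted $x^{pD}$. *)

(* Defs.v *)
From mathcomp Require Import all_boot all_algebra.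
From mathcomp Require Import boolp classical_sets.

Set Implicit Arguments.
Unset Strict Implicit.
Unset Printing Implicit Defensive.

Import GRing.Theory.
Local Open Scope classical_set_scope.
Local Open Scope ring_scope.

(* [pzRingType]: associative unital rings, not assumed commutative, the zero
   ring being allowed. *)
Definition left_ideal (R : pzRingType) (I : set R) : Prop :=
  [/\ I 0,
      forall x y : R, I x -> I y -> I (x + y)
    & forall r x : R, I x -> I (r * x)].

Definition maximal_left_ideal (R : pzRingType) (M : set R) : Prop :=
  [/\ left_ideal M,
      M <> setT
    & forall I : set R, left_ideal I -> M `<=` I -> I = M \/ I = setT].

(* In the zero ring there is no maximal left ideal, and the radical is the
   whole ring, as it should be. *)
Definition jacobson_radical (R : pzRingType) : set R :=
  \bigcap_(M in [set M : set R | maximal_left_ideal M]) M.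

Definition jacobson_sharp (R : pzRingType) : set R :=
  [set x | exists n : nat, (0 < n)%N /\ jacobson_radical (x ^+ n)].

Definition comm1 (R : pzRingType) (x : R) : set R :=
  [set y | x * y = y * x].

Definition comm2 (R : pzRingType) (x : R) : set R :=
  [set y | forall z : R, comm1 x z -> y * z = z * y].

Definition is_pDinv (R : pzRingType) (x y : R) : Prop :=
  [/\ x * y ^+ 2 = y,
      comm2 x y
    & jacobson_sharp (x ^+ 2 * y - x)].

Definition pD_invertible (R : pzRingType) (x : R) : Prop :=
  exists y : R, is_pDinv x y.

(* The value is 0 by convention when [x] is not pseudo Drazin invertible. *)
Definition pDinv (R : pzRingType) (x : R) : R :=
  xget 0 [set y | is_pDinv x y].

(* Main.v *)
(* Write p = ab with pseudo Drazin inverse y, and q = ba. If z commutes with q,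
   then azb commutes with p, hence with y; this puts b y^2 a in comm^2(q). Since
   q^2 (b y^2 a) - q = b (p y - 1) a, its (n+1)-st power is
   b (p^2 y - p)^n (p y - 1) a, which is in J(R) as J(R) is two-sided.
   For uniqueness, two pseudo Drazin inverses c, d of x commute, and
   x d (1 - x c) is an idempotent which is a multiple of the n-th power of
   x^2 c - x; it is therefore in J(R), and so it is 0. *)

Require Import Defs.
From mathcomp Require Import all_boot all_algebra.
From mathcomp Require Import boolp classical_sets.
Import GRing.Theory.
Local Open Scope ring_scope.

Lemma left_idealB (R : pzRingType) (I : set R) (x y : R) :
  left_ideal I -> I x -> I y -> I (x - y).
Proof.
by move=> [_ ID IM] Ix Iy; apply: ID => //; rewrite -mulN1r; apply: IM.
Qed.

Lemma left_ideal1 (R : pzRingType) (I : set R) :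
  left_ideal I -> I 1 -> I = setT.
Proof.
move=> [_ _ IM] I1; apply/seteqP; split=> // x _.
by rewrite -[x]mulr1; apply: IM.
Qed.

Lemma left_ideal_jacobson (R : pzRingType) :
  left_ideal (@jacobson_radical R).
Proof.
split=> [M|x y Jx Jy M|r x Jx M] Mmax; have [[M0 MD MM] _ _] := Mmax => //.
- by apply: MD; [apply: Jx|apply: Jy].
- by apply: MM; apply: Jx.
Qed.

(** This is the annihilator of the class of [r] in the simple module [R / M]. It lets
    [jacobson_mulr] show that a radical defined by left ideals also absorbs factors on the right. *)
Lemma maximal_left_ideal_quotient (R : pzRingType) (M : set R) (r : R) :
  maximal_left_ideal M -> ~ M r ->
  maximal_left_ideal [set s | M (s * r)]%classic.
Proof.
move=> [Mid _ Mmax] nMr; have [M0 MD MM] := Mid; split.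
- split=> /= [|x y Mx My|s x Mx]; first by rewrite mul0r.
  + by rewrite mulrDl; apply: MD.
  + by rewrite -mulrA; apply: MM.
- by move=> /seteqP[_ /(_ 1 I)] /=; rewrite mul1r.
- move=> I Iid sMI; have [I0 ID IM] := Iid.
  pose N := [set t | exists m i, [/\ M m, I i & t = m + i * r]]%classic.
  have Nid : left_ideal N.
    split.
    + by exists 0, 0; rewrite mul0r addr0.
    + move=> _ _ [m [i [Mm Ii ->]]] [m' [i' [Mm' Ii' ->]]].
      exists (m + m'), (i + i'); split; [exact: MD|exact: ID|].
      by rewrite mulrDl addrACA.
    + move=> s _ [m [i [Mm Ii ->]]]; exists (s * m), (s * i).
      by rewrite mulrDr mulrA; split; [exact: MM|exact: IM|].
  have sMN : (M `<=` N)%classic.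
    by move=> m Mm; exists m, 0; rewrite mul0r addr0.
  have [NM|NT] := Mmax N Nid sMN; [left|right].
  + apply/seteqP; split=> // i Ii /=; rewrite -NM.
    by exists 0, i; rewrite add0r.
  (* From [s * r = m + i * r], the difference [s - i] multiplies [r] into [M], hence lies in [I]. *)
  + apply/seteqP; split=> // s _.
    have [m [i [Mm Ii sr]]] : N (s * r) by rewrite NT.
    rewrite -[s](subrK i); apply: ID => //; apply: sMI => /=.
    by rewrite mulrBl sr addrK.
Qed.

Lemma jacobson_mulr (R : pzRingType) (x r : R) :
  jacobson_radical x -> jacobson_radical (x * r).
Proof.
move=> Jx M Mmax; have [[_ _ MM] _ _] := Mmax.
have [Mr|nMr] := pselect (M r); first exact: MM.
exact: Jx _ (maximal_left_ideal_quotient _ _ _ Mmax nMr).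
Qed.

Lemma exists_maximal_left_ideal (R : pzRingType) (K : set R) :
  left_ideal K -> ~ K 1 ->
  exists2 M : set R, maximal_left_ideal M & (K `<=` M)%classic.
Proof.
move=> Kid nK1.
(* Zorn is applied to the I with K `|` I a proper left ideal, so that the
   empty chain has an upper bound too. *)
pose P := [set I | left_ideal (K `|` I) /\ ~ (K `|` I) 1]%classic.
have [|A [[Aid nA1] Amax]] := @Zorn_bigcup R P.
  move=> F FP Ftot.
  have KIU I : F I -> (K `|` I `<=` K `|` \bigcup_(X in F) X)%classic.
    by move=> FI; apply: setUS; apply: bigcup_sup.
  have [K0 KD KM] := Kid.
  split; last by case=> // -[I FI I1]; case: (FP I FI) => _; apply; right.
  split; first by left.
  - move=> x y [Kx|[I FI Ix]] [Ky|[I' FI' Iy]].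
    + by left; apply: KD.
    + have [[_ ID _] _] := FP _ FI'.
      by apply: (KIU _ FI'); apply: ID; [left|right].
    + have [[_ ID _] _] := FP _ FI.
      by apply: (KIU _ FI); apply: ID; [right|left].
    + have [sII'|sI'I] := Ftot _ _ FI FI'.
      * have [[_ ID _] _] := FP _ FI'.
        by apply: (KIU _ FI'); apply: ID; right=> //; apply: sII'.
      * have [[_ ID _] _] := FP _ FI.
        by apply: (KIU _ FI); apply: ID; right=> //; apply: sI'I.
  - move=> r x [Kx|[I FI Ix]]; first by left; apply: KM.
    have [[_ _ IM] _] := FP _ FI.
    by apply: (KIU _ FI); apply: IM; right.
exists (K `|` A)%classic; last exact: subsetUl.
split=> //; first by move=> AT; apply: nA1; rewrite AT.
move=> I Iid sAI; have [I1|nI1] := pselect (I 1).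
  by right; exact: left_ideal1 Iid I1.
left; apply: contrapT => neqI.
(* As [I] contains [K], it belongs to [P] itself, and it would properly extend the maximal [A]. *)
have KI : (K `|` I = I)%classic.
  by apply: setUidr; apply: subset_trans sAI; apply: subsetUl.
apply: (Amax I); last by rewrite /P /mkset KI.
split; first by apply: subset_trans sAI; apply: subsetUr.
move=> sIA; apply: neqI; apply/seteqP; split=> //.
by apply: subset_trans sIA _; apply: subsetUr.
Qed.

(** If [g] is nonzero, its left annihilator is proper and contains [1 - g]. A maximal left ideal
    above it also contains [g], hence 1. *)
Lemma jacobson_idempotent (R : pzRingType) (g : R) :
  g * g = g -> jacobson_radical g -> g = 0.
Proof.
move=> gg Jg; apply: contrapT => g0.
pose K := [set x | x * g = 0]%classic.
have Kid : left_ideal K.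
  rewrite /K; split=> /= [|x y xg yg|r x xg]; first by rewrite mul0r.
  - by rewrite mulrDl xg yg addr0.
  - by rewrite -mulrA xg mulr0.
have [|M Mmax sKM] := exists_maximal_left_ideal R K Kid.
  by rewrite /K /= mul1r.
have [Mid MT _] := Mmax; apply/MT/left_ideal1 => //.
have [_ MD _] := Mid; rewrite -[1](subrK g); apply: MD; last exact: Jg.
by apply: sKM; rewrite /K /= mulrBl mul1r gg subrr.
Qed.

Lemma comm2_refl (R : pzRingType) (x y : R) : comm2 x y -> x * y = y * x.
Proof. by move=> /(_ x erefl). Qed.

Lemma idempotent_exp (R : pzRingType) (g : R) (n : nat) :
  g * g = g -> (0 < n)%N -> g ^+ n = g.
Proof.
by move=> gg; case: n => // n _; elim: n => // n IH; rewrite exprS IH.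
Qed.

Lemma is_pDinv_absorb (R : pzRingType) (x c d : R) :
  is_pDinv x c -> is_pDinv x d -> d * (x * c) = d.
Proof.
move=> [xcc c2 [n [n0 Jn]]] [xdd d2 _].
have xc := comm2_refl R x c c2; have xd := comm2_refl R x d d2.
have cd : c * d = d * c by apply: c2.
have ddx : d * d * x = d by rewrite -mulrA -xd mulrA -xd -mulrA -expr2.
have cxc : c * x * c = c by rewrite -xc -mulrA -expr2.
pose u := x ^+ 2 * c - x; pose g := d * u.
have ux : u = x * (x * c - 1) by rewrite mulrBr mulr1 mulrA -expr2.
have du : GRing.comm d u.
  have dx : GRing.comm d x by apply: esym.
  by apply: commrB => //; apply: commrM; [apply: commrX|apply: esym].
have uxc : u * (x * c) = 0.
  have -> : u * (x * c) = x * x * (c * x * c) - x * x * c.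
    by rewrite /u mulrBl expr2 !mulrA.
  by rewrite cxc subrr.
(* On the right, [g] absorbs [d * x] and is killed by [x * c], so
   [g * g = g * (x * c - 1) = - g]. *)
have gg : (- g) * (- g) = - g.
  rewrite mulrNN {2}/g ux !mulrA.
  have gdx : g * d * x = g.
    by rewrite /g du -!mulrA (mulrA d d) ddx.
  by rewrite gdx mulrBr mulr1 /g -mulrA uxc mulr0 sub0r.
have g0 : - g = 0.
  apply: jacobson_idempotent => //.
  rewrite -(idempotent_exp R (- g) n gg n0) -mulNr exprMn_comm.
    have [_ _ JM] := left_ideal_jacobson R; exact: JM.
  by rewrite /GRing.comm mulNr mulrN du.
(* Since [d * d * x = d], the product [d * g] is [d * (x * c) - d]. *)
have /eqP : d * g = 0 by rewrite -[g]opprK g0 oppr0 mulr0.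
by rewrite /g ux !mulrA ddx mulrBr mulr1 subr_eq0 mulrA => /eqP.
Qed.

Lemma is_pDinv_unique (R : pzRingType) (x c d : R) :
  is_pDinv x c -> is_pDinv x d -> c = d.
Proof.
move=> Hc Hd; have [_ c2 _] := Hc; have [_ d2 _] := Hd.
have xc := comm2_refl R x c c2; have xd := comm2_refl R x d d2.
(* Absorption in both directions turns the goal into [c * (x * d) = d * (x * c)], where all factors
   commute. *)
rewrite -(is_pDinv_absorb R x d c Hd Hc) -{2}(is_pDinv_absorb R x c d Hc Hd).
by rewrite !mulrA -xc -xd -!mulrA (c2 _ xd).
Qed.

Lemma pDinvE (R : pzRingType) (x y : R) : is_pDinv x y -> pDinv x = y.
Proof.
by move=> Hy; apply: xget_unique => // z Hz; apply: is_pDinv_unique Hz Hy.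
Qed.

Lemma expr_mul_swap (R : pzRingType) (a b : R) (n : nat) :
  (a * b) ^+ n.+1 = a * (b * a) ^+ n * b.
Proof.
elim: n => [|n IH]; first by rewrite expr1 expr0 mulr1.
by rewrite exprS IH [in RHS]exprS !mulrA.
Qed.

Lemma is_pDinv_swap (R : pzRingType) (a b y : R) :
  is_pDinv (a * b) y -> is_pDinv (b * a) (b * y ^+ 2 * a).
Proof.
move=> [pyy y2 [n [n0 Jn]]].
have py := comm2_refl R _ y y2; set p := a * b in pyy y2 Jn py.
have pya : y ^+ 2 * p = y by rewrite expr2 -mulrA -py mulrA -py -mulrA -expr2.
split.
- have -> : b * a * (b * y ^+ 2 * a) ^+ 2
    = b * (p * y ^+ 2) * (p * y ^+ 2) * a.
    by rewrite expr2 /p !mulrA.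
  by rewrite pyy expr2 !mulrA.
- move=> z qz.
  have pz : p * (a * z * b) = a * z * b * p.
    have -> : p * (a * z * b) = a * (b * a * z) * b by rewrite /p !mulrA.
    by rewrite qz /p !mulrA.
  (* Passing to the cube frees a factor [p = a * b] on either side of [y]. Its letters, moved past
     [z] by [qz], form the block [a * z * b] that commutes with [y]. *)
  have y3p : y ^+ 3 * p = y ^+ 2 by rewrite exprS -mulrA pya expr2.
  have py3 : p * y ^+ 3 = y ^+ 2 by rewrite exprSr mulrA pyy expr2.
  have y3z : y ^+ 3 * (a * z * b) = a * z * b * y ^+ 3.
    by apply/esym/commrX/esym/y2.
  transitivity (b * (y ^+ 3 * (a * z * b)) * a).
    have -> : b * (y ^+ 3 * (a * z * b)) * a = b * y ^+ 3 * a * (z * (b * a)).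
      by rewrite !mulrA.
    by rewrite -qz -y3p /p !mulrA.
  have -> : b * (y ^+ 3 * (a * z * b)) * a = (b * a * z) * b * y ^+ 3 * a.
    by rewrite y3z !mulrA.
  by rewrite qz -py3 /p !mulrA.
(* One extra factor is needed: in [expr_mul_swap], the outer [b] and [(p * y - 1) * a] use up one
   exponent and leave an [n]-th power inside. *)
- exists n.+1; split=> //.
  have -> : (b * a) ^+ 2 * (b * y ^+ 2 * a) - b * a = b * ((p * y - 1) * a).
    rewrite mulrBl mul1r mulrBr; congr (_ - _).
    by rewrite -{2}pyy /p expr2 !mulrA.
  rewrite expr_mul_swap.
  have -> : (p * y - 1) * a * b = p ^+ 2 * y - p.
    by rewrite -mulrA -/p mulrBl mul1r -mulrA -py mulrA -expr2.
  have [_ _ JM] := left_ideal_jacobson R.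
  by apply: jacobson_mulr; apply: JM.
Qed.

Theorem theorem2p9 (R : pzRingType) (a b : R) :
  pD_invertible (a * b) ->
  pD_invertible (b * a) /\
  pDinv (b * a) = b * (pDinv (a * b)) ^+ 2 * a.
Proof.
move=> [y Hy]; have Hc := is_pDinv_swap R a b y Hy.
by split; [exists (b * y ^+ 2 * a)|rewrite (pDinvE R _ _ Hy); apply: pDinvE].
Qed.
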